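(* For any $\rho \in \mathbb{R}_{+}^{m}$, the compliance $$\pi(\rho) = \sup_{u \in \mathbb{R}^{\bar{n}}} \{\, 2 f^{\top} u - u^{\top} K(\rho) u \;\mid\; D u = 0,\ C_{\mathrm{n}} u \le g \,\}$$ coincides with the optimal value of the following optimization problem in the variables $w = (w_1,\dots,w_m)^{\top} \in \mathbb{R}^{m}$, $s_{e} \in \mathbb{R}^{5}$ ($e=1,\dots,m$), $t \in \mathbb{R}^{d}$, and $r \in \mathbb{R}^{c}$: $$\begin{aligned} \text{Minimize}\quad & \sum_{e=1}^{m} w_{e} - 2 g^{\top} r \\ \text{subject to}\quad & w_{e} \rho_{e}^{p} \ge s_{e}^{\top} \kappa^{-1} s_{e}, \qquad e=1,\dots,m, \\ & \sum_{e=1}^{m} B_{e} s_{e} = f + D^{\top} t + C_{\mathrm{n}}^{\top} r, \\ & r \le 0. \end{aligned}$$ Here, if this minimization problem is infeasible, then its optimal value is defined to be $+\infty$.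
   Context: Setting (discretized elastic continuum with frictionless unilateral contact, SIMP material interpolation). Let $m$ be the number of finite elements, $\bar{n}$ the dimension of the nodal displacement vector (twice the number of nodes), $d$ the number of scalar displacement boundary conditions, and $c$ the number of contact candidate nodes. The data are: an external load vector $f \in \mathbb{R}^{\bar{n}}$; a constant matrix $D \in \mathbb{R}^{d \times \bar{n}}$ (Dirichlet boundary conditions $Du=0$); a constant matrix $C_{\mathrm{n}} \in \mathbb{R}^{c \times \bar{n}}$ (consisting of the unit inner normal vectors of the obstacle surface); the vector of initial gaps $g \in \mathbb{R}^{c}$ with $g_{j} \ge 0$ for all $j$; the penalization power $p > 1$; a constant symmetric positive definite matrix $\kappa \in \mathbb{R}^{5 \times 5}$ (the same for all elements); and constant matrices $B_{e} \in \mathbb{R}^{\bar{n} \times 5}$ ($e=1,\dots,m$). For a vector of element densities $\rho = (\rho_1,\dots,\rho_m)^{\top}$, the stiffness matrix is $$K(\rho) = \sum_{e=1}^{m} \rho_{e}^{p} K_{e}, \qquad K_{e} = B_{e} \kappa B_{e}^{\top}.$$ $\mathbb{R}_{+}^{m}$ is the nonnegative orthant; inequalities between vectors are componentwise.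
   Formalization: The constraint w_e ≥ 0 is added to the minimization problem; without it the claim fails when some ρ_e = 0 and the problem is feasible (w_e is then free and the value is −∞, while π(ρ) ≥ 0). For ρ_e > 0 it is implied by the stated constraint. *)

(* Defs.v *)
From HB Require Import structures.
From mathcomp Require Export all_boot all_order all_algebra.
From mathcomp Require Export all_classical all_reals all_analysis.
Set Implicit Arguments.
Unset Strict Implicit.
Unset Printing Implicit Defensive.
Import Order.TTheory GRing.Theory Num.Theory.
Local Open Scope classical_set_scope.
Local Open Scope ring_scope.

Definition cvdot (R : realType) (n : nat) (x y : 'cV[R]_n) : R :=
  (x^T *m y) 0 0.

Definition qform (R : realType) (n : nat) (A : 'M[R]_n) (x : 'cV[R]_n) : R :=
  (x^T *m A *m x) 0 0.

Definition cvle (R : realType) (n : nat) (x y : 'cV[R]_n) : Prop :=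
  forall i, x i 0 <= y i 0.

Definition sym_posdef (R : realType) (n : nat) (A : 'M[R]_n) : Prop :=
  A^T = A /\ forall x : 'cV[R]_n, x != 0 -> 0 < qform A x.

Definition elem_stiffness (R : realType) (n : nat) (kappa : 'M[R]_5)
    (Be : 'M[R]_(n, 5)) : 'M[R]_n :=
  Be *m kappa *m Be^T.

Definition stiffness (R : realType) (m n : nat) (p : R) (kappa : 'M[R]_5)
    (B : 'I_m -> 'M[R]_(n, 5)) (rho : 'cV[R]_m) : 'M[R]_n :=
  \sum_(e < m) (rho e 0 `^ p) *: elem_stiffness kappa (B e).

(* The supremum is taken in \bar R: it is +oo when the load can do unbounded
   work on an admissible displacement (e.g. on an unsupported void region). *)
Definition compliance (R : realType) (m n d c : nat) (f : 'cV[R]_n)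
    (D : 'M[R]_(d, n)) (Cn : 'M[R]_(c, n)) (g : 'cV[R]_c) (p : R)
    (kappa : 'M[R]_5) (B : 'I_m -> 'M[R]_(n, 5)) (rho : 'cV[R]_m) : \bar R :=
  ereal_sup [set z : \bar R | exists u : 'cV[R]_n,
    [/\ D *m u = 0, cvle (Cn *m u) g &
        z = (2 * cvdot f u - qform (stiffness p kappa B rho) u)%:E]].

(* The constraint [0 <= w_e] belongs to the rotated second-order cone
   {(w, y, s) | w * y >= s^T kappa^-1 s, w >= 0, y >= 0}.  It follows from the
   quadratic inequality when [0 < rho_e] (lemma [cone_w_ge0] below), but not
   when [rho_e = 0]: there the inequality only says [s_e = 0], and a free [w_e]
   would make the objective unbounded below. *)
Definition feasible (R : realType) (m n d c : nat) (f : 'cV[R]_n)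
    (D : 'M[R]_(d, n)) (Cn : 'M[R]_(c, n)) (p : R)
    (kappa : 'M[R]_5) (B : 'I_m -> 'M[R]_(n, 5)) (rho : 'cV[R]_m)
    (w : 'cV[R]_m) (s : 'I_m -> 'cV[R]_5) (t : 'cV[R]_d) (r : 'cV[R]_c) : Prop :=
  [/\ forall e, w e 0 * rho e 0 `^ p >= qform (invmx kappa) (s e),
      forall e, 0 <= w e 0,
      \sum_(e < m) B e *m s e = f + D^T *m t + Cn^T *m r &
      cvle r 0].

(* [ereal_inf set0 = +oo] is the convention for an infeasible problem. *)
Definition min_value (R : realType) (m n d c : nat) (f : 'cV[R]_n)
    (D : 'M[R]_(d, n)) (Cn : 'M[R]_(c, n)) (g : 'cV[R]_c) (p : R)
    (kappa : 'M[R]_5) (B : 'I_m -> 'M[R]_(n, 5)) (rho : 'cV[R]_m) : \bar R :=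
  ereal_inf [set z : \bar R | exists w s t r,
    feasible f D Cn p kappa B rho w s t r /\
    z = (\sum_(e < m) w e 0 - 2 * cvdot g r)%:E].

Lemma sym_posdef_unit (R : realType) (n : nat) (A : 'M[R]_n) :
  sym_posdef A -> A \in unitmx.
Proof.
move=> [AT Apos]; rewrite -row_free_unit -kermx_eq0; apply/eqP/row_matrixP => i.
rewrite row0; apply: contraTeq isT => ker_neq0.
set v := row i (kermx A); have vA : v *m A = 0 by rewrite -row_mul mulmx_ker row0.
have /Apos : v^T != 0 by rewrite -trmx0 (inj_eq trmx_inj).
by rewrite /qform trmxK vA mul0mx mxE ltxx.
Qed.

Lemma cone_w_ge0 (R : realType) (kappa : 'M[R]_5) (w y : R) (s : 'cV[R]_5) :
  sym_posdef kappa -> 0 < y -> w * y >= qform (invmx kappa) s -> 0 <= w.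
Proof.
move=> kpos y_gt0 hw; rewrite -(pmulr_lge0 _ y_gt0); apply: le_trans hw.
have ku := sym_posdef_unit kpos; case: kpos => kT kpos.
have -> : qform (invmx kappa) s = qform kappa (invmx kappa *m s).
  by rewrite /qform trmx_mul trmx_inv kT mulmxA mulmxKV.
have [->|/kpos/ltW//] := eqVneq (invmx kappa *m s) 0.
by rewrite /qform mulmx0 mxE.
Qed.

(* Main.v *)
Require Import Defs.
From mathcomp Require Import ring lra.
Import Order.TTheory GRing.Theory Num.Theory.
Local Open Scope classical_set_scope.
Local Open Scope ring_scope.

(** The statement is strong duality between a concave quadratic program and a
    conic program.

    Weak duality ([weak_duality]) is a computation.  Substituting the force
    balance into [f . u] and using the sign conditions on the contact forces [r]
    reduces it to one inequality per element,
    [2 s . e - a (e . kappa e) <= w] with strain [e = B^T u] and stiffness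
    factor [a], which is a Fenchel-Young inequality for [kappa]
    ([fenchel_young_qform]).

    For the converse, suppose that the real [M] bounds the quadratic objective
    on the admissible displacements.  Two steps give a feasible point of the
    minimization problem of value at most [M], so that no duality gap is left
    and the minimum is even attained when it is finite.

    First, Lagrange multipliers for the kinematic constraints exist
    ([multiplier_exists]), because the objective is concave and finite
    everywhere, and the constraints are affine and consistent ([u = 0] is
    admissible since the gaps are nonnegative).  The proof adds one constraint
    at a time.  If the new inequality [l <= 0] can be strictly satisfied, its
    multiplier is a slope separating the points with [l > 0] from those with
    [l < 0] ([separating_slope]), or zero if this slope is negative.  If not, it is an implicit equality; it is moved to the list of equalities, where its
    multiplier may get the wrong sign, and a Farkas identity, itself provided by
    the induction hypothesis, trades this multiplier for admissible ones.

    Second, the Lagrangian, [2 h . u - u . K u] up to a constant, is bounded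
    above on the whole space, with [h] the sum of the load and the reactions.
    Hence [h] vanishes on the kernel of [K], that is [h = K v] for some [v]
    ([bounded_quadratic_range]).  The stresses and energies of the displacement
    [v], [s_e = a_e kappa B_e^T v] and [w_e = a_e (B_e^T v) . kappa B_e^T v],
    solve the minimization problem. *)

(** * Affine and concave functions *)

Definition affine_fun {R : realType} {V : lmodType R} (l : V -> R) : Prop :=
  forall (a : R) x y, l (a *: x + (1 - a) *: y) = a * l x + (1 - a) * l y.

Definition concave_fun {R : realType} {V : lmodType R} (q : V -> R) : Prop :=
  forall (a : R) x y, 0 <= a <= 1 ->
    a * q x + (1 - a) * q y <= q (a *: x + (1 - a) *: y).

Definition convex_set {R : realType} {V : lmodType R} (X : V -> Prop) : Prop :=
  forall (a : R) x y, 0 <= a <= 1 -> X x -> X y -> X (a *: x + (1 - a) *: y).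

Definition lagrange {R : realType} {V : lmodType R} {J : finType}
    (l : J -> V -> R) (lam : J -> R) (x : V) : R :=
  \sum_j lam j * l j x.

Definition admissible {R : realType} {V : lmodType R} {J : finType}
    (l : J -> V -> R) (E L : seq J) (x : V) : Prop :=
  (forall j, j \in E -> l j x = 0) /\ (forall j, j \in L -> l j x <= 0).

(** Multipliers are indexed by all of [J] and required to vanish outside the
    active constraints [E] and [L], so that multipliers for different sets of
    constraints can be added. *)
Definition multiplier {R : realType} {J : finType} (E L : seq J)
    (lam : J -> R) : Prop :=
  (forall j, j \notin E -> 0 <= lam j) /\
  (forall j, j \notin E -> j \notin L -> lam j = 0).

Lemma affine_concave {R : realType} {V : lmodType R} (l : V -> R) :
  affine_fun l -> concave_fun l.
Proof. by move=> ha a x y _; rewrite ha. Qed.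

Lemma affine_lincomb {R : realType} {V : lmodType R} (k l : V -> R) (b c : R) :
  affine_fun k -> affine_fun l -> affine_fun (fun x => b * k x + c * l x).
Proof. by move=> hk hl a x y /=; rewrite hk hl; ring. Qed.

Lemma concave_sub_affine {R : realType} {V : lmodType R} (q l : V -> R) (b : R) :
  concave_fun q -> affine_fun l -> concave_fun (fun x => q x - b * l x).
Proof. by move=> hq hl a x y ha /=; have := hq a x y ha; rewrite hl; lra. Qed.

Lemma affine_lagrange {R : realType} {V : lmodType R} {J : finType}
    (l : J -> V -> R) (lam : J -> R) :
  (forall j, affine_fun (l j)) -> affine_fun (lagrange l lam).
Proof.
move=> hl a x y; rewrite /lagrange !mulr_sumr -big_split; apply: eq_bigr => j _ /=.
by rewrite hl; ring.
Qed.

(** Extrapolating beyond [x0] reflects values about [l x0]: an affine function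
    vanishing at [x0] takes both signs as soon as it is not zero. *)
Lemma affine_reflect {R : realType} {V : lmodType R} (l : V -> R) (x0 x : V) :
  affine_fun l -> l (2 *: x0 + (1 - 2) *: x) = 2 * l x0 - l x.
Proof. by move=> hl; rewrite hl; ring. Qed.

Lemma affine_ge0_eq0 {R : realType} {V : lmodType R} (l : V -> R) (x0 : V) :
  affine_fun l -> (forall x, 0 <= l x) -> l x0 <= 0 -> forall x, l x = 0.
Proof.
move=> hl l_ge0 l0 x.
have := l_ge0 (2 *: x0 + (1 - 2) *: x); rewrite affine_reflect//.
by have := l_ge0 x; have := l_ge0 x0; lra.
Qed.

Lemma admissible_convex {R : realType} {V : lmodType R} {J : finType}
    (l : J -> V -> R) (E L : seq J) :
  (forall j, affine_fun (l j)) -> convex_set (admissible l E L).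
Proof.
move=> hl a x y /andP[a0 a1] [xE xL] [yE yL]; split=> j hj; rewrite hl.
  by rewrite xE// yE// !mulr0 addr0.
by have := xL _ hj; have := yL _ hj; nra.
Qed.

Lemma lagrangeD {R : realType} {V : lmodType R} {J : finType}
    (l : J -> V -> R) (lam mu : J -> R) (b : R) (x : V) :
  lagrange l (fun j => lam j + b * mu j) x
  = lagrange l lam x + b * lagrange l mu x.
Proof.
rewrite /lagrange mulr_sumr -big_split; apply: eq_bigr => j _ /=.
by rewrite mulrDl mulrA.
Qed.

Lemma lagrange_delta {R : realType} {V : lmodType R} {J : finType}
    (l : J -> V -> R) (k : J) (x : V) :
  lagrange l (fun j => (j == k)%:R) x = l k x.
Proof.
rewrite /lagrange (bigD1 k)//= eqxx mul1r big1 ?addr0// => j /negbTE ->.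
by rewrite mul0r.
Qed.

Lemma lagrange_le0 {R : realType} {V : lmodType R} {J : finType}
    (l : J -> V -> R) (E L : seq J) (lam : J -> R) (x : V) :
  multiplier E L lam -> admissible l E L x -> lagrange l lam x <= 0.
Proof.
move=> [lam_ge0 lam0] [xE xL]; apply: sumr_le0 => j _.
have [jE|jE] := boolP (j \in E); first by rewrite xE// mulr0.
have [jL|jL] := boolP (j \in L); last by rewrite lam0// mul0r.
by apply: mulr_ge0_le0; [exact: lam_ge0|exact: xL].
Qed.

(** * Lagrange multipliers for affine constraints *)

(** A multiplier [lam] must lie above the slopes [(q x - M) / l x] of the points
    with [0 < l x] and below those of the points with [l x < 0].  The segment
    joining two such points crosses the hyperplane [l = 0], where [q] is at most
    [M], so concavity puts every slope of the first kind below every slope of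
    the second kind; the supremum of the former separates them. *)
Lemma separating_slope {R : realType} {V : lmodType R} (X : V -> Prop)
    (q l : V -> R) (M : R) (xp xn : V) :
  convex_set X -> concave_fun q -> affine_fun l ->
  X xp -> 0 < l xp -> X xn -> l xn < 0 ->
  (forall x, X x -> l x = 0 -> q x <= M) ->
  exists lam, forall x, X x -> q x - lam * l x <= M.
Proof.
move=> hX hq hl Xp lp Xn ln qM.
have slopes x y : X x -> 0 < l x -> X y -> l y < 0 ->
    (q x - M) / l x <= (q y - M) / l y.
  move=> Xx lx Xy ly.
  (* the point of the segment [x, y] on the hyperplane l = 0 *)
  pose a := - l y / (l x - l y).
  have lxy : 0 < l x - l y by lra.
  have aE : a * (l x - l y) = - l y by rewrite /a divfK// gt_eqF.
  have ha : 0 <= a <= 1.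
    by rewrite /a divr_ge0 ?ler_pdivrMr//; lra.
  have := qM _ (hX a x y ha Xx Xy).
  have -> : l (a *: x + (1 - a) *: y) = 0 by rewrite hl; lra.
  move=> /(_ erefl) /(le_trans (hq a x y ha)) hM.
  rewrite ler_pdivrMr// mulrAC ler_ndivlMr//.
  have : (a * q x + (1 - a) * q y) * (l x - l y) <= M * (l x - l y).
    by rewrite ler_wpM2r// ltW.
  have -> : (a * q x + (1 - a) * q y) * (l x - l y) =
    (a * (l x - l y)) * q x + ((l x - l y) - a * (l x - l y)) * q y by ring.
  by rewrite aE; lra.
pose A := [set z | exists x, [/\ X x, 0 < l x & z = (q x - M) / l x]].
have Aub y : X y -> l y < 0 -> ubound A ((q y - M) / l y).
  by move=> Xy ly _ [x [Xx lx ->]]; exact: slopes.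
have A0 : A !=set0 by exists ((q xp - M) / l xp), xp.
exists (sup A) => x Xx; have [lx|lx|lx] := ltrgtP (l x) 0.
- have := ge_sup A0 (Aub _ Xx lx); rewrite ler_ndivlMr//; lra.
- have : (q x - M) / l x <= sup A.
    by apply: ub_le_sup; [exists ((q xn - M) / l xn); exact: Aub|exists x].
  by rewrite ler_pdivrMr//; lra.
- by rewrite lx mulr0 subr0; exact: qM.
Qed.

(** The constraint [l k] either vanishes identically on the affine subspace cut
    out by the remaining equalities, and is then redundant there, or takes both
    signs on it by reflection about [x0], and then a separating slope exists. *)
Lemma multiplier_equality {R : realType} {V : lmodType R} {J : finType}
    (l : J -> V -> R) (E : seq J) (q : V -> R) (M : R) (x0 : V) :
  (forall j, affine_fun (l j)) -> concave_fun q -> admissible l E [::] x0 ->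
  (forall x, admissible l E [::] x -> q x <= M) ->
  exists2 lam, multiplier E [::] lam & forall x, q x - lagrange l lam x <= M.
Proof.
move=> hl; elim: E q => [|k E IH] q hq x0E qM.
  exists (fun=> 0); first by split=> // j _.
  move=> x; rewrite /lagrange big1 ?subr0; last by move=> j _; rewrite mul0r.
  exact: qM.
have admk x : admissible l E [::] x -> l k x = 0 -> admissible l (k :: E) [::] x.
  by move=> [xE _] xk; split=> // j; rewrite inE => /predU1P[->//|/xE].
have lk0 : l k x0 = 0 by apply: x0E.1; rewrite inE eqxx.
have x0E' : admissible l E [::] x0.
  by split=> // j jE; apply: x0E.1; rewrite inE jE orbT.
have [a ha] : exists a, forall x, admissible l E [::] x -> q x - a * l k x <= M.
  have [[x Xx lx]|no] := pselect (exists2 x, admissible l E [::] x & l k x != 0).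
    pose x' := 2 *: x0 + (1 - 2) *: x.
    have lx' : l k x' = - l k x by rewrite affine_reflect// lk0 mulr0 sub0r.
    have Xx' : admissible l E [::] x'.
      split=> // j jE; rewrite affine_reflect// x0E'.1// Xx.1//; ring.
    have hX := admissible_convex l E [::] hl.
    have qM0 y : admissible l E [::] y -> l k y = 0 -> q y <= M.
      by move=> Xy ly; apply: qM; exact: admk.
    have [l0|l0|l0] := ltrgtP (l k x) 0; last by rewrite l0 eqxx in lx.
      by apply: (separating_slope _ _ _ _ x' x hX hq (hl k)) => //; lra.
    by apply: (separating_slope _ _ _ _ x x' hX hq (hl k)) => //; lra.
  exists 0 => x Xx; rewrite mul0r subr0; apply/qM/admk => //.
  by apply/eqP/negPn/negP => lx; apply: no; exists x.
have [lam [lam_ge0 lam0] hlam] := IH _ (concave_sub_affine _ _ a hq (hl k)) x0E' ha.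
exists (fun j => lam j + a * (j == k)%:R).
  by split=> j; rewrite inE negb_or => /andP[/negbTE -> jE]; rewrite mulr0 addr0;
    [exact: lam_ge0|move=> _; exact: lam0].
by move=> x; rewrite lagrangeD lagrange_delta; have := hlam x; lra.
Qed.

(** The equalities [E] are generalized in the induction on [L], because an
    inequality that admissible points satisfy only with equality is moved from
    [L] to [E]. *)
Lemma multiplier_exists {R : realType} {V : lmodType R} {J : finType}
    (l : J -> V -> R) (E L : seq J) (q : V -> R) (M : R) (x0 : V) :
  (forall j, affine_fun (l j)) -> concave_fun q -> admissible l E L x0 ->
  (forall x, admissible l E L x -> q x <= M) ->
  exists2 lam, multiplier E L lam & forall x, q x - lagrange l lam x <= M.
Proof.
move=> hl; elim: L E q M => [|k L IH] E q M hq x0EL qM.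
  exact: multiplier_equality x0EL qM.
have x0EL' : admissible l E L x0.
  by split=> j jE; [exact: x0EL.1|apply: x0EL.2; rewrite inE jE orbT].
have x0k : l k x0 <= 0 by apply: x0EL.2; rewrite inE eqxx.
have admk x : admissible l E L x -> l k x <= 0 -> admissible l E (k :: L) x.
  by move=> [xE xL] xk; split=> // j; rewrite inE => /predU1P[->//|/xL].
have extend lam a : multiplier E L lam -> 0 <= a ->
    multiplier E (k :: L) (fun j => lam j + a * (j == k)%:R).
  move=> [lam_ge0 lam0] a0; split=> j jE.
    by rewrite addr_ge0 ?lam_ge0// mulr_ge0.
  by rewrite inE negb_or => /andP[/negbTE -> jL]; rewrite mulr0 addr0 lam0.
(* Either the constraint k can be satisfied strictly (a Slater point), or it is
   an implicit equality. *)
have [[xn Xn ln]|no] := pselect (exists2 x, admissible l E L x & l k x < 0).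
  have [a a0 ha] : exists2 a, 0 <= a &
      forall x, admissible l E L x -> q x - a * l k x <= M.
    have [[xp Xp lp]|nop] := pselect (exists2 x, admissible l E L x & 0 < l k x).
      have [|a ha] := separating_slope _ q (l k) M xp xn
        (admissible_convex l E L hl) hq (hl k) Xp lp Xn ln.
        by move=> x Xx lx; apply/qM/admk => //; rewrite lx.
      (* If the separating slope is negative, the constraint k is not binding. *)
      have [a0|a0] := leP 0 a; first by exists a.
      exists 0 => // x Xx; rewrite mul0r subr0.
      have [lx|lx] := leP (l k x) 0; first exact/qM/admk.
      by have := ha x Xx; nra.
    exists 0 => // x Xx; rewrite mul0r subr0; apply/qM/admk => //.
    by rewrite leNgt; apply/negP => lx; apply: nop; exists x.
  have [lam hm hlam] := IH _ _ _ (concave_sub_affine _ _ a hq (hl k)) x0EL' ha.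
  exists (fun j => lam j + a * (j == k)%:R); first exact: extend.
  by move=> x; rewrite lagrangeD lagrange_delta; have := hlam x; lra.
have lk_ge0 x : admissible l E L x -> 0 <= l k x.
  by move=> Xx; rewrite leNgt; apply/negP => lx; apply: no; exists x.
(* Farkas: as - l k <= 0 on the other constraints, the induction hypothesis for
   the objective - l k gives an affine function l k + sum_j mu_j l_j that is
   nonnegative everywhere and nonpositive at x0, hence zero. *)
have [mu hmu lmu] : exists2 mu, multiplier E L mu &
    forall x, l k x + lagrange l mu x = 0.
  have hN : affine_fun (fun x => (-1) * l k x + 0 * l k x).
    exact: affine_lincomb.
  have [|mu hmu hle] := IH E _ 0 (affine_concave _ hN) x0EL'.
    by move=> x /lk_ge0; lra.
  exists mu => // x.
  have hS : affine_fun (fun x => 1 * l k x + 1 * lagrange l mu x).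
    by apply: affine_lincomb => //; exact: affine_lagrange.
  have := affine_ge0_eq0 _ x0 hS _ _ x; rewrite !mul1r; apply.
    by move=> y; have := hle y; lra.
  by have := lagrange_le0 l E L mu x0 hmu x0EL'; lra.
have [||lam [lam_ge0 lam0] hlam] := IH (k :: E) q M hq.
- split=> [j|]; last exact: x0EL'.2.
  rewrite inE => /predU1P[->|]; last exact: x0EL'.1.
  by apply/eqP; rewrite eq_le x0k lk_ge0.
- move=> x [xE xL]; apply/qM/admk; last by rewrite xE ?inE ?eqxx.
  by split=> // j jE; apply: xE; rewrite inE jE orbT.
(* The multiplier of k, whose sign is free since k was treated as an equality,
   is split off. *)
pose lam' j := if j == k then 0 else lam j.
have hm' : multiplier E L lam'.
  split=> j jE; rewrite /lam'; case: eqVneq => // jk.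
    by apply: lam_ge0; rewrite inE negb_or jk.
  by move=> jL; apply: lam0 => //; rewrite inE negb_or jk.
have lamE x : lagrange l lam x = lagrange l lam' x + lam k * l k x.
  rewrite -(lagrange_delta l k) -lagrangeD; apply: eq_bigr => j _; rewrite /lam'.
  by case: eqVneq => [->|_]; rewrite ?mulr1 ?add0r// mulr0 addr0.
have [k0|k0] := leP 0 (lam k).
  exists (fun j => lam' j + lam k * (j == k)%:R); first exact: extend.
  by move=> x; rewrite lagrangeD lagrange_delta -lamE.
(* A negative multiple of l k is a positive multiple of sum_j mu_j l_j. *)
exists (fun j => lam' j + (- lam k) * mu j).
  have [h1 h2] := hm'; have [g1 g2] := hmu; split=> j jE.
    by rewrite addr_ge0 ?h1// mulr_ge0 ?g1// oppr_ge0 ltW.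
  by rewrite inE negb_or => /andP[_ jL]; rewrite h2// g2// mulr0 addr0.
move=> x; rewrite lagrangeD; have := hlam x; rewrite lamE; have := lmu x; nra.
Qed.

(** * Quadratic forms *)

Lemma cvdotE {R : realType} {n : nat} (x y : 'cV[R]_n) :
  cvdot x y = \sum_i x i 0 * y i 0.
Proof. by rewrite /cvdot mxE; apply: eq_bigr => i _; rewrite mxE. Qed.

Lemma cvdotC {R : realType} {n : nat} (x y : 'cV[R]_n) : cvdot x y = cvdot y x.
Proof. by rewrite !cvdotE; apply: eq_bigr => i _; rewrite mulrC. Qed.

Lemma cvdotDr {R : realType} {n : nat} (x y z : 'cV[R]_n) :
  cvdot x (y + z) = cvdot x y + cvdot x z.
Proof. by rewrite /cvdot mulmxDr mxE. Qed.

Lemma cvdotZr {R : realType} {n : nat} (a : R) (x y : 'cV[R]_n) :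
  cvdot x (a *: y) = a * cvdot x y.
Proof. by rewrite /cvdot -scalemxAr mxE. Qed.

Lemma cvdot0r {R : realType} {n : nat} (x : 'cV[R]_n) : cvdot x 0 = 0.
Proof. by rewrite /cvdot mulmx0 mxE. Qed.

Lemma cvdotDl {R : realType} {n : nat} (x y z : 'cV[R]_n) :
  cvdot (x + y) z = cvdot x z + cvdot y z.
Proof. by rewrite !(cvdotC _ z) cvdotDr. Qed.

Lemma cvdotZl {R : realType} {n : nat} (a : R) (x y : 'cV[R]_n) :
  cvdot (a *: x) y = a * cvdot x y.
Proof. by rewrite !(cvdotC _ y) cvdotZr. Qed.

Lemma cvdot_suml {R : realType} {n : nat} {I : finType} (x : I -> 'cV[R]_n)
    (y : 'cV[R]_n) :
  cvdot (\sum_i x i) y = \sum_i cvdot (x i) y.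
Proof. by rewrite /cvdot raddf_sum mulmx_suml summxE. Qed.

Lemma cvdot_mulmxl {R : realType} {n k : nat} (A : 'M[R]_(n, k)) x y :
  cvdot (A *m x) y = cvdot x (A^T *m y).
Proof. by rewrite /cvdot trmx_mul mulmxA. Qed.

Lemma qform_cvdot {R : realType} {n : nat} (A : 'M[R]_n) x :
  qform A x = cvdot x (A *m x).
Proof. by rewrite /qform /cvdot mulmxA. Qed.

Lemma qform_lincomb {R : realType} {n : nat} (A : 'M[R]_n) (a b : R) x y :
  A^T = A ->
  qform A (a *: x + b *: y)
  = a ^+ 2 * qform A x + 2 * (a * b * cvdot x (A *m y)) + b ^+ 2 * qform A y.
Proof.
move=> AT; rewrite !qform_cvdot mulmxDr -!scalemxAr.
rewrite !(cvdotDl, cvdotDr, cvdotZl, cvdotZr).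
have -> : cvdot y (A *m x) = cvdot x (A *m y).
  by rewrite cvdotC cvdot_mulmxl AT.
ring.
Qed.

Lemma qform_ge0 {R : realType} {n : nat} (A : 'M[R]_n) x :
  sym_posdef A -> 0 <= qform A x.
Proof.
move=> [_ Apos]; have [->|/Apos/ltW//] := eqVneq x 0.
by rewrite /qform mulmx0 mxE.
Qed.

Lemma qform_invmx {R : realType} {n : nat} (A : 'M[R]_n) x :
  sym_posdef A -> qform (invmx A) x = qform A (invmx A *m x).
Proof.
move=> Apos; have Au := sym_posdef_unit Apos; case: Apos => AT _.
by rewrite /qform trmx_mul trmx_inv AT mulmxA mulmxKV.
Qed.

(** For [0 < a], expand the nonnegative value of [qform A] at
    [a e - A^-1 s] and divide by [a].  For [a = 0], the hypothesis forces
    [s = 0], and the conclusion is [0 <= w]. *)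
Lemma fenchel_young_qform {R : realType} {n : nat} (A : 'M[R]_n) (w a : R)
    (s e : 'cV[R]_n) :
  sym_posdef A -> 0 <= w -> 0 <= a -> qform (invmx A) s <= w * a ->
  2 * cvdot s e - a * qform A e <= w.
Proof.
move=> Apos w0; rewrite le_eqVlt => /predU1P[<-|a0] hs.
  have -> : s = 0.
    rewrite -[s](mulKVmx (sym_posdef_unit Apos)).
    have [->|nz] := eqVneq (invmx A *m s) 0; first by rewrite mulmx0.
    by move: hs; rewrite mulr0 qform_invmx// leNgt Apos.2.
  by rewrite cvdotC cvdot0r; lra.
have := qform_ge0 _ (a *: e + (-1) *: (invmx A *m s)) Apos.
rewrite qform_lincomb; last by case: Apos.
rewrite -qform_invmx// mulmxA mulmxV ?sym_posdef_unit// mul1mx (cvdotC e).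
move=> h; rewrite -(ler_pM2r a0); nra.
Qed.

(** The concavity defect at [x], [y] with weight [a] is
    [a (1 - a) qform K (x - y)]. *)
Lemma concave_quadratic {R : realType} {n : nat} (K : 'M[R]_n) (f : 'cV[R]_n) :
  K^T = K -> (forall u, 0 <= qform K u) ->
  concave_fun (fun u => 2 * cvdot f u - qform K u).
Proof.
move=> KT K0 a x y /andP[a0 a1].
rewrite qform_lincomb// cvdotDr !cvdotZr.
have := K0 (1 *: x + (-1) *: y); rewrite qform_lincomb// => h.
have : 0 <= a * (1 - a) by rewrite mulr_ge0 ?subr_ge0.
nra.
Qed.

(** If [h] were not in the range of [K], some kernel vector [z] of [K] would have
    [h . z != 0], and the objective would be linear and unbounded along [z].
    When [K v = h], the value of the objective at [v] is [qform K v]. *)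
Lemma bounded_quadratic_range {R : realType} {n : nat} (K : 'M[R]_n)
    (h : 'cV[R]_n) (M : R) :
  K^T = K -> (forall u, 2 * cvdot h u - qform K u <= M) ->
  exists2 v, K *m v = h & qform K v <= M.
Proof.
move=> KT hM.
have /submxP[v hv] : (h^T <= K)%MS.
  rewrite submxE; apply/eqP/rowP => j; rewrite [RHS]mxE; apply/eqP/negPn/negP => nz.
  pose z := col j (cokermx K).
  have Kz : K *m z = 0 by rewrite /z colE mulmxA mulmx_coker mul0mx.
  have hz : cvdot h z != 0 by rewrite /cvdot /z colE mulmxA -colE mxE.
  (* At this multiple of z the objective is exactly M + 1. *)
  have := hM (((M + 1) / cvdot h z / 2) *: z).
  rewrite qform_cvdot -scalemxAr Kz scaler0 cvdotZr cvdot0r.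
  have -> : 2 * ((M + 1) / cvdot h z / 2 * cvdot h z) = M + 1 by field.
  by lra.
have vh : K *m v^T = h by rewrite -[RHS]trmxK hv trmx_mul KT.
exists v^T => //.
by have := hM v^T; rewrite cvdotC qform_cvdot vh; lra.
Qed.

(** * Duality for the compliance problem *)

Lemma qform_stiffness {R : realType} {m n : nat} (p : R) (kappa : 'M[R]_5)
    (B : 'I_m -> 'M[R]_(n, 5)) (rho : 'cV[R]_m) (u : 'cV[R]_n) :
  qform (stiffness p kappa B rho) u
  = \sum_e rho e 0 `^ p * qform kappa ((B e)^T *m u).
Proof.
rewrite /qform /stiffness mulmx_sumr mulmx_suml summxE; apply: eq_bigr => e _.
by rewrite -scalemxAr -scalemxAl mxE /elem_stiffness trmx_mul trmxK !mulmxA.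
Qed.

Lemma stiffness_sym {R : realType} {m n : nat} (p : R) (kappa : 'M[R]_5)
    (B : 'I_m -> 'M[R]_(n, 5)) (rho : 'cV[R]_m) :
  kappa^T = kappa -> (stiffness p kappa B rho)^T = stiffness p kappa B rho.
Proof.
move=> kT; rewrite /stiffness raddf_sum; apply: eq_bigr => e _ /=.
by rewrite linearZ /= /elem_stiffness !trmx_mul trmxK kT mulmxA.
Qed.

Lemma weak_duality {R : realType} {m n d c : nat} (f : 'cV[R]_n)
    (D : 'M[R]_(d, n)) (Cn : 'M[R]_(c, n)) (g : 'cV[R]_c) (p : R)
    (kappa : 'M[R]_5) (B : 'I_m -> 'M[R]_(n, 5)) (rho : 'cV[R]_m)
    (u : 'cV[R]_n) w s t r :
  sym_posdef kappa -> D *m u = 0 -> cvle (Cn *m u) g ->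
  feasible f D Cn p kappa B rho w s t r ->
  2 * cvdot f u - qform (stiffness p kappa B rho) u
  <= \sum_e w e 0 - 2 * cvdot g r.
Proof.
move=> kpos Du Cu [hs w0 eqf r0].
have fu : cvdot f u = \sum_e cvdot (s e) ((B e)^T *m u) - cvdot r (Cn *m u).
  have <- : cvdot (\sum_e B e *m s e) u = \sum_e cvdot (s e) ((B e)^T *m u).
    by rewrite cvdot_suml; apply: eq_bigr => e _; rewrite cvdot_mulmxl.
  rewrite eqf !cvdotDl !cvdot_mulmxl !trmxK Du cvdot0r; ring.
have hr : cvdot g r <= cvdot r (Cn *m u).
  rewrite cvdotC !cvdotE; apply: ler_sum => j _.
  by have := r0 j; rewrite [X in _ <= X]mxE; have := Cu j; nra.
have hw : 2 * (\sum_e cvdot (s e) ((B e)^T *m u))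
    - qform (stiffness p kappa B rho) u <= \sum_e w e 0.
  rewrite qform_stiffness mulr_sumr -sumrB; apply: ler_sum => e _.
  by apply: fenchel_young_qform; rewrite ?powR_ge0.
by rewrite fu; lra.
Qed.

Lemma strong_duality {R : realType} {m n d c : nat} (f : 'cV[R]_n)
    (D : 'M[R]_(d, n)) (Cn : 'M[R]_(c, n)) (g : 'cV[R]_c) (p : R)
    (kappa : 'M[R]_5) (B : 'I_m -> 'M[R]_(n, 5)) (rho : 'cV[R]_m) (M : R) :
  sym_posdef kappa -> cvle 0 g ->
  (forall u, D *m u = 0 -> cvle (Cn *m u) g ->
     2 * cvdot f u - qform (stiffness p kappa B rho) u <= M) ->
  exists w s t r, feasible f D Cn p kappa B rho w s t r /\
    \sum_e w e 0 - 2 * cvdot g r <= M.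
Proof.
move=> kpos g0; set K := stiffness p kappa B rho => hM.
have KT : K^T = K by apply: stiffness_sym; case: kpos.
have K0 u : 0 <= qform K u.
  rewrite qform_stiffness; apply: sumr_ge0 => e _.
  by rewrite mulr_ge0 ?powR_ge0 ?qform_ge0.
pose l (j : 'I_d + 'I_c) (u : 'cV[R]_n) := match j with
  | inl i => (D *m u) i 0 | inr i => (Cn *m u) i 0 - g i 0 end.
have hl j : affine_fun (l j).
  by move=> a x y; case: j => i /=; rewrite mulmxDr -!scalemxAr !mxE; ring.
pose E := [seq inl i | i <- enum 'I_d] : seq ('I_d + 'I_c).
pose L := [seq inr i | i <- enum 'I_c] : seq ('I_d + 'I_c).
have adm u : admissible l E L u <-> D *m u = 0 /\ cvle (Cn *m u) g.
  split=> [[uE uL]|[Du Cu]].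
    split=> [|i].
      apply/colP => i; rewrite [RHS]mxE.
      by apply: (uE (inl i)); rewrite map_f// mem_enum.
    by rewrite -subr_le0; apply: (uL (inr i)); rewrite map_f// mem_enum.
  by split=> _ /mapP[i _ ->] /=; [rewrite Du mxE|rewrite subr_le0].
have adm0 : admissible l E L 0.
  by apply/adm; rewrite !mulmx0; split.
have [|lam [lam_ge0 _] hlam] :=
  multiplier_exists l E L _ M 0 hl (concave_quadratic K f KT K0) adm0.
  by move=> u /adm[]; exact: hM.
(* Constraints enter the Lagrangian as lam * l, reactions as - 2 t . D u and
   - 2 r . Cn u; this fixes the factor - 1/2. *)
pose t : 'cV[R]_d := \col_i (- (lam (inl i) / 2)).
pose r : 'cV[R]_c := \col_i (- (lam (inr i) / 2)).
have lagE u : lagrange l lam u =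
    - 2 * cvdot t (D *m u) - 2 * cvdot r (Cn *m u) + 2 * cvdot g r.
  rewrite /lagrange big_sumType /= !cvdotE -addrA; congr +%R.
    by rewrite mulr_sumr; apply: eq_bigr => i _; rewrite [t i 0]mxE; field.
  rewrite !mulr_sumr -sumrN -big_split; apply: eq_bigr => i _ /=.
  by rewrite [r i 0]mxE; field.
have [|v Kv hv] :=
  bounded_quadratic_range K (f + D^T *m t + Cn^T *m r) (M + 2 * cvdot g r) KT.
  move=> u; have := hlam u; rewrite lagE !cvdotDl !cvdot_mulmxl !trmxK; lra.
(* Strains and stiffness factors of the displacement v. *)
pose eps e := (B e)^T *m v; pose a e := rho e 0 `^ p.
exists (\col_e (a e * qform kappa (eps e))), (fun e => a e *: (kappa *m eps e)), t, r.
split; last first.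
  under eq_bigr do rewrite mxE.
  by rewrite -qform_stiffness -/K; lra.
split.
- move=> e; rewrite mxE qform_invmx// -scalemxAr mulmxA mulVmx ?sym_posdef_unit//.
  rewrite mul1mx !qform_cvdot -scalemxAr cvdotZl cvdotZr -/(a e); lra.
- by move=> e; rewrite mxE mulr_ge0 ?powR_ge0 ?qform_ge0.
- rewrite -Kv /K /stiffness mulmx_suml; apply: eq_bigr => e _.
  by rewrite -scalemxAr -scalemxAl /elem_stiffness !mulmxA.
- move=> i; rewrite !mxE oppr_le0 divr_ge0// lam_ge0//.
  by apply/mapP => -[j _].
Qed.

Theorem theorem2 (R : realType) (m n d c : nat)
    (f : 'cV[R]_n) (D : 'M[R]_(d, n)) (Cn : 'M[R]_(c, n)) (g : 'cV[R]_c)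
    (p : R) (kappa : 'M[R]_5) (B : 'I_m -> 'M[R]_(n, 5))
    (g_ge0 : cvle 0 g) (p_gt1 : 1 < p) (kappa_spd : sym_posdef kappa)
    (rho : 'cV[R]_m) (rho_ge0 : cvle 0 rho) :
  compliance f D Cn g p kappa B rho = min_value f D Cn g p kappa B rho.
Proof.
apply/eqP; rewrite eq_le; apply/andP; split.
  apply: ge_ereal_sup => _ [u [Du Cu ->]].
  apply: le_ereal_inf_tmp => _ [w [s [t [r [hfeas ->]]]]].
  rewrite lee_fin; exact: weak_duality hfeas.
set q := fun u => 2 * cvdot f u - qform (stiffness p kappa B rho) u.
have le_compl u : D *m u = 0 -> cvle (Cn *m u) g ->
    ((q u)%:E <= compliance f D Cn g p kappa B rho)%E.
  by move=> Du Cu; apply: ereal_sup_ubound; exists u.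
case Epi : (compliance f D Cn g p kappa B rho) le_compl => [M| |] le_compl.
- have [|w [s [t [r [hfeas hle]]]]] := strong_duality f D Cn g p kappa B rho M kappa_spd g_ge0.
    by move=> u Du Cu; have := le_compl u Du Cu; rewrite lee_fin.
  apply: (@le_trans _ _ (\sum_e w e 0 - 2 * cvdot g r)%:E); last by rewrite lee_fin.
  by apply: ereal_inf_lbound; exists w, s, t, r.
- exact: leey.
- by have := le_compl 0; rewrite !mulmx0 => /(_ erefl g_ge0).
Qed.
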